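(* Let $(\phi_t)$ be a non-elliptic semigroup in $\mathbb{D}$, with orthogonal speed $v^o(t)$ and tangential speed $v^T(t)$. Then, for every $t\geq 0$, $$v^T(t)\leq v^o(t)+4\log 2.$$
   Context: Let $\mathbb{D}=\{\zeta\in\mathbb{C}:|\zeta|<1\}$ with hyperbolic distance $\omega(z,w)=\frac12\log\frac{1+|T_z(w)|}{1-|T_z(w)|}$, $T_z(w)=\frac{z-w}{1-\overline{z}w}$. A non-elliptic semigroup in $\mathbb{D}$ is a family $(\phi_t)_{t\ge0}$ of holomorphic maps $\phi_t:\mathbb{D}\to\mathbb{D}$ such that $\phi_0=\mathrm{id}$, $\phi_{t+s}=\phi_t\circ\phi_s$ for all $s,t\ge0$, $t\mapsto\phi_t$ is continuous for the topology of uniform convergence on compacta of $\mathbb{D}$, and $\phi_t$ has no fixed point in $\mathbb{D}$ for $t>0$. Its Denjoy-Wolff point is the unique $\tau\in\partial\mathbb{D}$ such that $\lim_{t\to\infty}\phi_t(z)=\tau$ for all $z\in\mathbb{D}$. Let $\gamma:(-1,1)\to\mathbb{D}$, $\gamma(r)=r\tau$ (a geodesic), and for $z\in\mathbb{D}$ let $\pi_\gamma(z)$ be the unique point of $\gamma((-1,1))$ closest to $z$ with respect to $\omega$. The orthogonal speed is $v^o(t):=\omega(0,\pi_\gamma(\phi_t(0)))$ and the tangential speed is $v^T(t):=\omega(\phi_t(0),\pi_\gamma(\phi_t(0)))$, $t\ge0$. *)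

(* Defs.v *)
(* Real and complex analysis on the standard library's [R] and Coquelicot's [C]. *)
From Stdlib Require Import Reals List.
From Coquelicot Require Import Coquelicot.
Open Scope R_scope.

Definition unit_disc (z : C) : Prop := Cmod z < 1.

(* A map of the disc is a total function on [C] of which only the values on
   [unit_disc] matter; as [unit_disc] is open, differentiability at its points does not
   depend on the values outside. *)
Definition holomorphic_on_disc (f : C -> C) : Prop :=
  forall z : C, unit_disc z -> ex_derive (K := C_AbsRing) (V := C_NormedModule) f z.

Definition compact_set (K : C -> Prop) : Prop :=
  forall F : (C -> Prop) -> Prop,
    (forall U, F U -> open U) ->
    (forall z, K z -> exists U, F U /\ U z) ->
    exists l : list (C -> Prop),
      (forall U, In U l -> F U) /\
      (forall z, K z -> exists U, In U l /\ U z).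

Record nonelliptic_semigroup (phi : R -> C -> C) : Prop := {
  nes_self : forall t z, 0 <= t -> unit_disc z -> unit_disc (phi t z);
  nes_holo : forall t, 0 <= t -> holomorphic_on_disc (phi t);
  nes_id : forall z, unit_disc z -> phi 0 z = z;
  nes_add : forall t s z, 0 <= t -> 0 <= s -> unit_disc z ->
    phi (t + s) z = phi t (phi s z);
  nes_cont : forall K : C -> Prop, compact_set K -> (forall z, K z -> unit_disc z) ->
    forall t0, 0 <= t0 -> forall eps : posreal,
      within (fun t => 0 <= t) (locally t0)
        (fun t => forall z, K z -> Cmod (phi t z - phi t0 z)%C < eps);
  nes_nofix : forall t z, 0 < t -> unit_disc z -> phi t z <> z
}.

Definition denjoy_wolff_point (phi : R -> C -> C) (tau : C) : Prop :=
  Cmod tau = 1 /\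
  forall z, unit_disc z ->
    filterlim (fun t => phi t z) (Rbar_locally p_infty) (locally tau).

Definition disc_aut (z w : C) : C := ((z - w) / (1 - Cconj z * w))%C.

Definition hyp_dist (z w : C) : R :=
  / 2 * ln ((1 + Cmod (disc_aut z w)) / (1 - Cmod (disc_aut z w))).

Definition radial_geodesic (tau : C) (r : R) : C := (RtoC r * tau)%C.

Definition closest_on_geodesic (tau z p : C) : Prop :=
  (exists r, -1 < r < 1 /\ p = radial_geodesic tau r) /\
  (forall r, -1 < r < 1 -> hyp_dist z p <= hyp_dist z (radial_geodesic tau r)).

(* [iota P] is the unique point satisfying [P], see [iota_correct]. *)
Definition geodesic_proj (tau z : C) : C :=
  iota (T := C_CompleteNormedModule) (closest_on_geodesic tau z).

Definition orthogonal_speed (phi : R -> C -> C) (tau : C) (t : R) : R :=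
  hyp_dist 0%R (geodesic_proj tau (phi t 0%R)).

Definition tangential_speed (phi : R -> C -> C) (tau : C) (t : R) : R :=
  hyp_dist (phi t 0%R) (geodesic_proj tau (phi t 0%R)).

(* Main.v *)
Require Import Defs.
From Stdlib Require Import Reals Classical_Prop Lra Lia.
From Coquelicot Require Import Coquelicot.
Open Scope R_scope.

(** Let [w = (tau + z) / (tau - z)] be the Cayley transform of the disc onto the right
    half-plane, sending [0] to [1] and [tau] to infinity. It maps the geodesic to the
    positive half-line, the closest point to [w] there is [Cmod w], and so, for
    [z = phi t 0], the orthogonal speed is [ln (Cmod w) / 2] as soon as [Cmod w >= 1],
    while the tangential speed is at most [ln (4 * Cmod w / Re w) / 2]. The result
    follows, even with [ln 2] in place of [4 * ln 2], from [Re w >= 1], that is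
    [Cmod (tau - z) ^ 2 <= 1 - Cmod z ^ 2]: the orbit of [0] stays in the horodisc at
    [tau] through [0] (lemma [horodisc_invariance]; the hyperbolic geometry is in [geodesic_proj_spec] and [tangential_le_orthogonal]).

    To prove this for [f = phi t], follow [z n = phi (n * t) 0], where
    [f (z n) = z (n + 1)]. As [Cmod (z n)] tends to [1] from below,
    [Cmod (z n) <= Cmod (f (z n))] for infinitely many [n]. For such [n], put
    [sg = f (z n) / Cmod (f (z n))] and apply Harnack's inequality between [0] and [z n] to
    the positive harmonic function [Re ((sg + f) / (sg - f))]; it gives
    [Cmod (sg - f 0) ^ 2 <= 1 - Cmod (f 0) ^ 2] ([julia_step]), and [sg] tends to [tau].

    Harnack's inequality ([harnack]) is obtained by integrating its infinitesimal form
    [Re p'(0) <= 2 * Re p(0)] for [Re p >= 0] ([deriv_le_of_Re_nonneg_disc]), transported by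
    disc automorphisms. Replacing [p z] by [p (r * z)] with [r < 1], one may take [p] holomorphic
    on the closed disc. The infinitesimal form then holds because the function
    [k z = p z * (2 - z - / z)] has nonnegative real part on the unit circle, where
    [z + / z = 2 * Re z], and because its mean over the circle of radius [rho] does not
    depend on [rho] and tends to [2 * p(0) - p'(0)] as [rho] tends to [0].

    The means are constant by Cauchy's theorem in logarithmic coordinates: the boundary
    integral of [k] over the rectangle [[a, b] x [0, 2 PI]] vanishes and the horizontal
    sides cancel by periodicity ([circle_mean_const]). As complex differentiability
    is assumed without continuity of the derivative, the vanishing is proved by Goursat's
    bisection, in the real form: a differentiable plane vector field of zero divergence
    has zero flux through the boundary of a rectangle ([flux_div_free]). *)

(** * Goursat's bisection for divergence-free vector fields *)

Lemma RInt_diff_approx (f g : R -> R) (a b k e : R) :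
  a <= b -> ex_RInt f a b -> ex_RInt g a b ->
  (forall t, a <= t <= b -> Rabs (f t - g t - k) <= e) ->
  Rabs (RInt f a b - RInt g a b - k * (b - a)) <= (b - a) * e.
Proof.
  intros Hab Hf Hg H.
  assert (Hfg : ex_RInt (fun t => minus (f t) (g t)) a b)
    by now apply (ex_RInt_minus (V := R_NormedModule)).
  assert (Hk : ex_RInt (fun _ : R => k) a b) by apply ex_RInt_const.
  assert (E : RInt (fun t => minus (minus (f t) (g t)) k) a b
              = RInt f a b - RInt g a b - k * (b - a)).
  { rewrite (RInt_minus (V := R_CompleteNormedModule)) by assumption.
    rewrite (RInt_minus (V := R_CompleteNormedModule)) by assumption.
    rewrite (RInt_const (V := R_CompleteNormedModule)).
    unfold minus, plus, opp, scal; simpl; unfold mult; simpl; ring. }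
  rewrite <- E. apply abs_RInt_le_const; [assumption | | exact H].
  now apply (ex_RInt_minus (V := R_NormedModule)).
Qed.

(** Flux of the vector field [(P, Q)] out of the rectangle [[a, b] x [c, d]]. *)
Definition flux (P Q : R -> R -> R) (a b c d : R) : R :=
  RInt (P b) c d - RInt (P a) c d
  + (RInt (fun x => Q x d) a b - RInt (fun x => Q x c) a b).

(** [(P, Q)] is totally differentiable at each point of the closed rectangle, with zero
    divergence there. No continuity of the partial derivatives is required. *)
Definition div_free_on (P Q : R -> R -> R) (a b c d : R) : Prop :=
  forall x y, a <= x <= b -> c <= y <= d ->
  exists lx ly mx my,
    differentiable_pt_lim P x y lx ly /\ differentiable_pt_lim Q x y mx my /\
    lx + my = 0.

Lemma differentiable_continuous_snd (P : R -> R -> R) (x y lx ly : R) :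
  differentiable_pt_lim P x y lx ly -> continuous (P x) y.
Proof.
  intros H. apply continuity_pt_filterlim.
  assert (Hc : continuity_2d_pt P x y)
    by (apply differentiable_continuity_pt; exists lx, ly; exact H).
  intros e He. destruct (Hc (mkposreal e He)) as [dl Hd]. exists dl. split; [apply dl|].
  intros z [_ Hz]. apply Hd; [rewrite Rminus_diag, Rabs_R0; apply dl | exact Hz].
Qed.

Lemma differentiable_continuous_fst (P : R -> R -> R) (x y lx ly : R) :
  differentiable_pt_lim P x y lx ly -> continuous (fun u => P u y) x.
Proof.
  intros H. apply continuity_pt_filterlim.
  assert (Hc : continuity_2d_pt P x y)
    by (apply differentiable_continuity_pt; exists lx, ly; exact H).
  intros e He. destruct (Hc (mkposreal e He)) as [dl Hd]. exists dl. split; [apply dl|].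
  intros z [_ Hz]. apply Hd; [exact Hz | rewrite Rminus_diag, Rabs_R0; apply dl].
Qed.

Lemma div_free_ex_RInt_fst P Q a b c d x u v :
  div_free_on P Q a b c d -> a <= x <= b -> c <= u -> u <= v -> v <= d ->
  ex_RInt (P x) u v.
Proof.
  intros H Hx Hu Huv Hv. apply (ex_RInt_continuous (V := R_CompleteNormedModule)).
  rewrite Rmin_left, Rmax_right by assumption. intros z Hz.
  destruct (H x z) as (lx & ly & mx & my & H1 & _); [assumption | lra |].
  exact (differentiable_continuous_snd _ _ _ _ _ H1).
Qed.

Lemma div_free_ex_RInt_snd P Q a b c d y u v :
  div_free_on P Q a b c d -> c <= y <= d -> a <= u -> u <= v -> v <= b ->
  ex_RInt (fun x => Q x y) u v.
Proof.
  intros H Hy Hu Huv Hv. apply (ex_RInt_continuous (V := R_CompleteNormedModule)).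
  rewrite Rmin_left, Rmax_right by assumption. intros z Hz.
  destruct (H z y) as (lx & ly & mx & my & _ & H2 & _); [lra | assumption |].
  exact (differentiable_continuous_fst _ _ _ _ _ H2).
Qed.

Lemma flux_quarter P Q a b c d (u m v p n q : R) :
  div_free_on P Q a b c d ->
  a <= u -> u <= m -> m <= v -> v <= b -> c <= p -> p <= n -> n <= q -> q <= d ->
  flux P Q u v p q =
  flux P Q u m p n + flux P Q m v p n + flux P Q u m n q + flux P Q m v n q.
Proof.
  intros H au um mv vb cp pn nq qd. unfold flux.
  assert (HP : forall x, a <= x <= b ->
            RInt (P x) p q = RInt (P x) p n + RInt (P x) n q).
  { intros x Hx. symmetry. apply (RInt_Chasles (V := R_CompleteNormedModule));
      eapply div_free_ex_RInt_fst; eauto; lra. }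
  assert (HQ : forall y, c <= y <= d ->
            RInt (fun x => Q x y) u v = RInt (fun x => Q x y) u m + RInt (fun x => Q x y) m v).
  { intros y Hy. symmetry. apply (RInt_Chasles (V := R_CompleteNormedModule) (fun x => Q x y));
      eapply div_free_ex_RInt_snd; eauto; lra. }
  rewrite (HP u), (HP v), (HQ p), (HQ q) by lra. ring.
Qed.

(** The flux of the affine part of the field vanishes, so that only the error of the affine
    approximation at [(x0, y0)] contributes. *)
Lemma flux_small P Q a b c d x0 y0 lx ly mx my e M :
  div_free_on P Q a b c d -> lx + my = 0 -> 0 <= e ->
  a <= x0 <= b -> c <= y0 <= d -> b - a <= M -> d - c <= M ->
  (forall x y, a <= x <= b -> c <= y <= d ->
     Rabs (P x y - P x0 y0 - (lx * (x - x0) + ly * (y - y0)))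
       <= e * Rmax (Rabs (x - x0)) (Rabs (y - y0))) ->
  (forall x y, a <= x <= b -> c <= y <= d ->
     Rabs (Q x y - Q x0 y0 - (mx * (x - x0) + my * (y - y0)))
       <= e * Rmax (Rabs (x - x0)) (Rabs (y - y0))) ->
  Rabs (flux P Q a b c d) <= 4 * e * M ^ 2.
Proof.
  intros H Hl He Hx0 Hy0 HM1 HM2 HP HQ.
  assert (HR : forall x y, a <= x <= b -> c <= y <= d ->
            e * Rmax (Rabs (x - x0)) (Rabs (y - y0)) <= e * M).
  { intros x y Hx Hy. apply Rmult_le_compat_l; [assumption|].
    apply Rmax_lub; apply Rabs_le; lra. }
  assert (H1 : Rabs (RInt (P b) c d - RInt (P a) c d - (lx * (b - a)) * (d - c))
               <= (d - c) * (2 * (e * M))).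
  { apply RInt_diff_approx; [lra | eapply div_free_ex_RInt_fst; eauto; lra
      | eapply div_free_ex_RInt_fst; eauto; lra |].
    intros t Ht.
    generalize (HP b t ltac:(lra) Ht) (HP a t ltac:(lra) Ht)
      (HR b t ltac:(lra) Ht) (HR a t ltac:(lra) Ht). intros E1 E2 E3 E4.
    replace (P b t - P a t - lx * (b - a)) with
      ((P b t - P x0 y0 - (lx * (b - x0) + ly * (t - y0)))
       - (P a t - P x0 y0 - (lx * (a - x0) + ly * (t - y0)))) by ring.
    eapply Rle_trans; [apply Rabs_triang|]. rewrite Rabs_Ropp. lra. }
  assert (H2 : Rabs (RInt (fun x => Q x d) a b - RInt (fun x => Q x c) a b
                     - (my * (d - c)) * (b - a)) <= (b - a) * (2 * (e * M))).
  { apply RInt_diff_approx; [lra | eapply div_free_ex_RInt_snd; eauto; lra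
      | eapply div_free_ex_RInt_snd; eauto; lra |].
    intros t Ht.
    generalize (HQ t d Ht ltac:(lra)) (HQ t c Ht ltac:(lra))
      (HR t d Ht ltac:(lra)) (HR t c Ht ltac:(lra)). intros E1 E2 E3 E4.
    replace (Q t d - Q t c - my * (d - c)) with
      ((Q t d - Q x0 y0 - (mx * (t - x0) + my * (d - y0)))
       - (Q t c - Q x0 y0 - (mx * (t - x0) + my * (c - y0)))) by ring.
    eapply Rle_trans; [apply Rabs_triang|]. rewrite Rabs_Ropp. lra. }
  assert (HeM : 0 <= e * M) by (apply Rmult_le_pos; lra).
  assert (H3 : (d - c) * (2 * (e * M)) <= M * (2 * (e * M)))
    by (apply Rmult_le_compat_r; lra).
  assert (H4 : (b - a) * (2 * (e * M)) <= M * (2 * (e * M)))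
    by (apply Rmult_le_compat_r; lra).
  unfold flux.
  replace (RInt (P b) c d - RInt (P a) c d
           + (RInt (fun x => Q x d) a b - RInt (fun x => Q x c) a b))
    with ((RInt (P b) c d - RInt (P a) c d - (lx * (b - a)) * (d - c)) +
          (RInt (fun x => Q x d) a b - RInt (fun x => Q x c) a b
                     - (my * (d - c)) * (b - a)))
    by (replace my with (- lx) by lra; ring).
  eapply Rle_trans; [apply Rabs_triang|]. simpl. lra.
Qed.

(** Among the four rectangles of sides [A] and [B] whose lower left corners are
    [xy + (i * A, j * B)] with [i, j] in [{0, 1}], the corner of one on which the set function
    [G] is at least [k], if there is one. *)
Definition corner_step (G : R -> R -> R) (A B k : R) (xy : R * R) : R * R :=
  let '(x, y) := xy in
  if Rle_dec k (G x y) then (x, y)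
  else if Rle_dec k (G (x + A) y) then (x + A, y)
  else if Rle_dec k (G x (y + B)) then (x, y + B)
  else (x + A, y + B).

(** Lower left corner of the rectangle kept after [n] bisections of [[a, b] x [c, d]] in both
    directions: a quarter of the preceding one, carrying at least a fourth of its flux in
    absolute value. *)
Fixpoint corner (P Q : R -> R -> R) (a b c d : R) (n : nat) : R * R :=
  match n with
  | O => (a, c)
  | S n =>
    let A := (b - a) * (/ 2) ^ S n in
    let B := (d - c) * (/ 2) ^ S n in
    corner_step (fun x y => Rabs (flux P Q x (x + A) y (y + B))) A B
      (Rabs (flux P Q a b c d) * (/ 4) ^ S n) (corner P Q a b c d n)
  end.

Lemma corner_spec P Q a b c d n :
  div_free_on P Q a b c d -> a <= b -> c <= d ->
  let A := (b - a) * (/ 2) ^ n in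
  let B := (d - c) * (/ 2) ^ n in
  let x := fst (corner P Q a b c d n) in
  let y := snd (corner P Q a b c d n) in
  a <= x /\ x + A <= b /\ c <= y /\ y + B <= d /\
  Rabs (flux P Q a b c d) * (/ 4) ^ n <= Rabs (flux P Q x (x + A) y (y + B)).
Proof.
  intros H Hab Hcd. induction n as [|n IH].
  { simpl. rewrite !Rmult_1_r. replace (a + (b - a)) with b by ring.
    replace (c + (d - c)) with d by ring. repeat split; lra. }
  assert (Hp : 0 < (/ 2) ^ n) by (apply pow_lt; lra).
  assert (HA : 0 <= (b - a) * (/ 2) ^ n) by (apply Rmult_le_pos; lra).
  assert (HB : 0 <= (d - c) * (/ 2) ^ n) by (apply Rmult_le_pos; lra).
  cbv zeta in IH |- *. simpl corner. simpl pow.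
  destruct (corner P Q a b c d n) as [x y]. simpl fst in IH; simpl snd in IH.
  replace ((b - a) * (/ 2 * (/ 2) ^ n)) with ((b - a) * (/ 2) ^ n / 2) by field.
  replace ((d - c) * (/ 2 * (/ 2) ^ n)) with ((d - c) * (/ 2) ^ n / 2) by field.
  replace (Rabs (flux P Q a b c d) * (/ 4 * (/ 4) ^ n))
    with (Rabs (flux P Q a b c d) * (/ 4) ^ n / 4) by field.
  set (A := (b - a) * (/ 2) ^ n) in *. set (B := (d - c) * (/ 2) ^ n) in *.
  set (F := Rabs (flux P Q a b c d) * (/ 4) ^ n) in *.
  destruct IH as (I1 & I2 & I3 & I4 & I5).
  unfold corner_step.
  destruct (Rle_dec _ _) as [h1|h1]; [simpl; repeat split; lra|].
  destruct (Rle_dec _ _) as [h2|h2]; [simpl; repeat split; lra|].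
  destruct (Rle_dec _ _) as [h3|h3]; [simpl; repeat split; lra|].
  simpl. repeat split; try lra.
  rewrite (flux_quarter P Q a b c d x (x + A / 2) (x + A) y (y + B / 2) (y + B)) in I5
    by (assumption || lra).
  replace (x + A / 2 + A / 2) with (x + A) in * by field.
  replace (y + B / 2 + B / 2) with (y + B) in * by field.
  set (f1 := flux P Q x (x + A / 2) y (y + B / 2)) in *.
  set (f2 := flux P Q (x + A / 2) (x + A) y (y + B / 2)) in *.
  set (f3 := flux P Q x (x + A / 2) (y + B / 2) (y + B)) in *.
  set (f4 := flux P Q (x + A / 2) (x + A) (y + B / 2) (y + B)) in *.
  generalize (Rabs_triang (f1 + f2 + f3) f4) (Rabs_triang (f1 + f2) f3) (Rabs_triang f1 f2).
  lra.
Qed.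

Lemma corner_mono P Q a b c d n m :
  div_free_on P Q a b c d -> a <= b -> c <= d ->
  let A := fun n => (b - a) * (/ 2) ^ n in
  let B := fun n => (d - c) * (/ 2) ^ n in
  let x := fun n => fst (corner P Q a b c d n) in
  let y := fun n => snd (corner P Q a b c d n) in
  x n <= x (n + m)%nat /\ x (n + m)%nat + A (n + m)%nat <= x n + A n /\
  y n <= y (n + m)%nat /\ y (n + m)%nat + B (n + m)%nat <= y n + B n.
Proof.
  intros H Hab Hcd. cbv zeta. induction m as [|m IH].
  { rewrite Nat.add_0_r. lra. }
  rewrite Nat.add_succ_r. set (k := (n + m)%nat) in *.
  assert (Hp : 0 < (/ 2) ^ k) by (apply pow_lt; lra).
  assert (HA : 0 <= (b - a) * (/ 2) ^ k) by (apply Rmult_le_pos; lra).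
  assert (HB : 0 <= (d - c) * (/ 2) ^ k) by (apply Rmult_le_pos; lra).
  simpl corner. simpl ((/ 2) ^ S k).
  destruct (corner P Q a b c d k) as [x y]. simpl fst in IH at 2 3; simpl snd in IH at 2 3.
  replace ((b - a) * (/ 2 * (/ 2) ^ k)) with ((b - a) * (/ 2) ^ k / 2) by field.
  replace ((d - c) * (/ 2 * (/ 2) ^ k)) with ((d - c) * (/ 2) ^ k / 2) by field.
  unfold corner_step.
  repeat (destruct (Rle_dec _ _)); simpl; simpl in IH; lra.
Qed.

Lemma nested_point (x L : nat -> R) :
  (forall n m, x n <= x (n + m)%nat /\ x (n + m)%nat + L (n + m)%nat <= x n + L n) ->
  (forall n, 0 <= L n) ->
  exists z, forall n, x n <= z <= x n + L n.
Proof.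
  intros H HL.
  assert (Hub : forall n k, x k <= x n + L n).
  { intros n k. destruct (Nat.le_ge_cases n k) as [h|h].
    - destruct (H n (k - n)%nat) as [_ h2]. replace (n + (k - n))%nat with k in h2 by lia.
      generalize (HL k). lra.
    - destruct (H k (n - k)%nat) as [h2 _]. replace (k + (n - k))%nat with n in h2 by lia.
      generalize (HL n). lra. }
  destruct (completeness (fun r => exists k, r = x k)) as [z [Hz1 Hz2]].
  - exists (x O + L O). intros r [k ->]. apply Hub.
  - exists (x O), O. reflexivity.
  - exists z. intros n. split.
    + apply Hz1. now exists n.
    + apply Hz2. intros r [k ->]. apply Hub.
Qed.

(** The rectangles kept by the bisection shrink to a point [(x0, y0)]; differentiability there
    makes their flux [o(4 ^ -n)], while it is at least [4 ^ -n] times the initial flux. *)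
Theorem flux_div_free P Q a b c d :
  a <= b -> c <= d -> div_free_on P Q a b c d -> flux P Q a b c d = 0.
Proof.
  intros Hab Hcd H.
  assert (Hp : forall n, 0 < (/ 2) ^ n) by (intros; apply pow_lt; lra).
  assert (HA : forall n, 0 <= (b - a) * (/ 2) ^ n)
    by (intros n; specialize (Hp n); apply Rmult_le_pos; lra).
  assert (HB : forall n, 0 <= (d - c) * (/ 2) ^ n)
    by (intros n; specialize (Hp n); apply Rmult_le_pos; lra).
  destruct (nested_point (fun n => fst (corner P Q a b c d n)) (fun n => (b - a) * (/ 2) ^ n))
    as [x0 Hx0]; [|exact HA|].
  { intros n m. generalize (corner_mono P Q a b c d n m H Hab Hcd). simpl. tauto. }
  destruct (nested_point (fun n => snd (corner P Q a b c d n)) (fun n => (d - c) * (/ 2) ^ n))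
    as [y0 Hy0]; [|exact HB|].
  { intros n m. generalize (corner_mono P Q a b c d n m H Hab Hcd). simpl. tauto. }
  destruct (H x0 y0) as (lx & ly & mx & my & HP & HQ & Hl).
  { generalize (Hx0 O). simpl. lra. }
  { generalize (Hy0 O). simpl. lra. }
  destruct (Req_dec (flux P Q a b c d) 0) as [|Hne]; [assumption|exfalso].
  assert (Hpos : 0 < Rabs (flux P Q a b c d)) by (apply Rabs_pos_lt; assumption).
  set (F := Rabs (flux P Q a b c d)) in *.
  (* [M] bounds both sides, and the added [1] makes it positive for a degenerate rectangle. *)
  set (M := 1 + (b - a) + (d - c)).
  assert (HM : 0 < M) by (unfold M; lra).
  assert (He : 0 < F / (8 * M ^ 2)).
  { apply Rdiv_lt_0_compat; [assumption|]. assert (0 < M ^ 2) by (apply pow_lt; lra). lra. }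
  set (e := mkposreal _ He).
  destruct (HP e) as [d1 Hd1]. destruct (HQ e) as [d2 Hd2].
  assert (Hd : 0 < Rmin d1 d2) by (apply Rmin_pos; [apply d1 | apply d2]).
  destruct (pow_lt_1_zero (/ 2) ltac:(rewrite Rabs_pos_eq; lra) (Rmin d1 d2 / M)) as [n Hn].
  { apply Rdiv_lt_0_compat; assumption. }
  specialize (Hn n (Nat.le_refl n)). rewrite Rabs_pos_eq in Hn by (apply Rlt_le, Hp).
  apply Rlt_div_r in Hn; [|assumption].
  generalize (corner_spec P Q a b c d n H Hab Hcd). cbv zeta. intros (S1 & S2 & S3 & S4 & S5).
  specialize (Hx0 n). specialize (Hy0 n). specialize (HA n). specialize (HB n). specialize (Hp n).
  cbv beta in Hx0, Hy0.
  set (x := fst (corner P Q a b c d n)) in *. set (y := snd (corner P Q a b c d n)) in *.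
  assert (HAM : (b - a) * (/ 2) ^ n <= M * (/ 2) ^ n)
    by (apply Rmult_le_compat_r; unfold M; lra).
  assert (HBM : (d - c) * (/ 2) ^ n <= M * (/ 2) ^ n)
    by (apply Rmult_le_compat_r; unfold M; lra).
  set (A := (b - a) * (/ 2) ^ n) in *. set (B := (d - c) * (/ 2) ^ n) in *.
  generalize (Rmin_l d1 d2) (Rmin_r d1 d2). intros Hm1 Hm2.
  assert (Hsm : Rabs (flux P Q x (x + A) y (y + B)) <= 4 * e * (M * (/ 2) ^ n) ^ 2).
  { apply (flux_small P Q x (x + A) y (y + B) x0 y0 lx ly mx my);
      try lra; try (apply Rlt_le, He).
    - intros u v Hu Hv. apply H; lra.
    - intros u v Hu Hv. apply Hd1; apply Rabs_def1; lra.
    - intros u v Hu Hv. apply Hd2; apply Rabs_def1; lra. }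
  assert (E : 4 * e * (M * (/ 2) ^ n) ^ 2 = F * (/ 4) ^ n / 2).
  { rewrite Rpow_mult_distr, <- pow_mult, Nat.mul_comm, pow_mult.
    replace ((/ 2) ^ 2) with (/ 4) by (simpl; field). simpl e. simpl. field. lra. }
  rewrite E in Hsm.
  assert (0 < F * (/ 4) ^ n) by (apply Rmult_lt_0_compat; [assumption | apply pow_lt; lra]).
  fold F in S5. lra.
Qed.

(** * Complex derivatives and means over circles *)

(** [f] has complex derivative [l] at [z]. The codomain carries its structure of normed module
    over itself, for which the product and chain rules are available. *)
Definition Cderiv (f : C -> C) (z l : C) : Prop :=
  @is_derive C_AbsRing (AbsRing_NormedModule C_AbsRing) f z l.

Lemma Cderiv_of_ex_derive (f : C -> C) (z : C) :
  ex_derive (K := C_AbsRing) (V := C_NormedModule) f z -> exists l, Cderiv f z l.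
Proof.
  intros [l [[H1 H2 H3] H4]]. exists l. split; [now constructor | exact H4].
Qed.

Lemma Cderiv_epsilon (f : C -> C) (z l : C) :
  Cderiv f z l <->
  forall eps, 0 < eps -> exists d, 0 < d /\
    forall w, Cmod (w - z)%C < d ->
      Cmod (f w - f z - (w - z) * l)%C <= eps * Cmod (w - z)%C.
Proof.
  split.
  - intros [_ H] eps He.
    destruct (H z (fun P HP => HP) (mkposreal eps He)) as [d Hd].
    exists d. split; [apply d|]. intros w Hw. apply Hd. exact Hw.
  - intros H. split.
    + apply is_linear_scal_l.
    + intros x Hx eps.
      rewrite <- (is_filter_lim_locally_unique (K := C_AbsRing)
                    (V := AbsRing_NormedModule C_AbsRing) z x Hx).
      destruct (H eps (cond_pos eps)) as (d & Hd & Hw).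
      exists (mkposreal d Hd). intros w Hb. apply Hw. exact Hb.
Qed.

Lemma Cderiv_eq (f : C -> C) (z l l' : C) : Cderiv f z l -> l = l' -> Cderiv f z l'.
Proof. now intros H <-. Qed.

Lemma Cderiv_id (z : C) : Cderiv (fun w => w) z 1%C.
Proof. exact (is_derive_id (K := C_AbsRing) z). Qed.

Lemma Cderiv_const (c z : C) : Cderiv (fun _ => c) z 0%C.
Proof. exact (is_derive_const (K := C_AbsRing) (V := AbsRing_NormedModule C_AbsRing) c z). Qed.

Lemma Cderiv_plus (f g : C -> C) (z lf lg : C) :
  Cderiv f z lf -> Cderiv g z lg -> Cderiv (fun w => f w + g w)%C z (lf + lg)%C.
Proof. exact (is_derive_plus (K := C_AbsRing) (V := AbsRing_NormedModule C_AbsRing) f g z lf lg). Qed.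

Lemma Cderiv_minus (f g : C -> C) (z lf lg : C) :
  Cderiv f z lf -> Cderiv g z lg -> Cderiv (fun w => f w - g w)%C z (lf - lg)%C.
Proof. exact (is_derive_minus (K := C_AbsRing) (V := AbsRing_NormedModule C_AbsRing) f g z lf lg). Qed.

Lemma Cderiv_mult (f g : C -> C) (z lf lg : C) :
  Cderiv f z lf -> Cderiv g z lg ->
  Cderiv (fun w => f w * g w)%C z (lf * g z + f z * lg)%C.
Proof.
  intros Hf Hg.
  exact (is_derive_mult (K := C_AbsRing) f g z lf lg Hf Hg Cmult_comm).
Qed.

Lemma Cderiv_comp (f g : C -> C) (z lf lg : C) :
  Cderiv f (g z) lf -> Cderiv g z lg -> Cderiv (fun w => f (g w)) z (lg * lf)%C.
Proof.
  exact (is_derive_comp (K := C_AbsRing) (V := AbsRing_NormedModule C_AbsRing) f g z lf lg).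
Qed.

Lemma Cmod_minus_rev (a b : C) : Cmod a - Cmod b <= Cmod (a - b)%C.
Proof.
  generalize (Cmod_triangle (a - b) b).
  replace (a - b + b)%C with a by ring. lra.
Qed.

Lemma Cderiv_inv (z : C) : z <> 0%C -> Cderiv (fun w => / w)%C z (- / (z * z))%C.
Proof.
  intros Hz. apply Cderiv_epsilon. intros eps He.
  assert (Hm : 0 < Cmod z) by now apply Cmod_gt_0.
  set (m := Cmod z) in *.
  exists (Rmin (m / 2) (eps * m ^ 3 / 2)). split.
  { apply Rmin_pos; [lra|]. assert (0 < m ^ 3) by now apply pow_lt.
    assert (0 < eps * m ^ 3) by now apply Rmult_lt_0_compat. lra. }
  intros w Hw.
  assert (Hw1 : Cmod (w - z) < m / 2) by (eapply Rlt_le_trans; [exact Hw | apply Rmin_l]).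
  assert (Hw2 : Cmod (w - z) < eps * m ^ 3 / 2)
    by (eapply Rlt_le_trans; [exact Hw | apply Rmin_r]).
  assert (Hwm : m / 2 <= Cmod w).
  { generalize (Cmod_minus_rev z w). replace (z - w)%C with (- (w - z))%C by ring.
    rewrite Cmod_opp. fold m. lra. }
  assert (Hw0 : w <> 0%C) by (apply Cmod_gt_0; lra).
  replace (/ w - / z - (w - z) * - / (z * z))%C
    with ((w - z) * ((w - z) * / (w * (z * z))))%C by (field; auto).
  rewrite Cmod_mult, Cmod_mult, Cmod_inv, !Cmod_mult
    by (repeat apply Cmult_neq_0; assumption). fold m.
  rewrite Rmult_comm. apply Rmult_le_compat_r; [apply Cmod_ge_0|].
  assert (Hp : 0 < Cmod w * (m * m)) by (repeat apply Rmult_lt_0_compat; lra).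
  apply Rle_div_l; [exact Hp|].
  apply Rle_trans with (eps * (m / 2 * (m * m))); [lra|].
  apply Rmult_le_compat_l; [lra|]. apply Rmult_le_compat_r; [nra | exact Hwm].
Qed.

Lemma Cderiv_div (f g : C -> C) (z lf lg : C) :
  g z <> 0%C -> Cderiv f z lf -> Cderiv g z lg ->
  Cderiv (fun w => f w / g w)%C z ((lf * g z - f z * lg) / (g z * g z))%C.
Proof.
  intros Hz Hf Hg.
  eapply Cderiv_eq.
  - apply (Cderiv_mult f (fun w => / g w)%C); [exact Hf|].
    apply (Cderiv_comp (fun w => / w)%C g); [apply Cderiv_inv; exact Hz | exact Hg].
  - field. exact Hz.
Qed.

Lemma Cmod_le_abs (a b : R) : Cmod (a, b) <= Rabs a + Rabs b.
Proof.
  replace (a, b) with (RtoC a + Ci * RtoC b)%C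
    by (unfold RtoC, Ci, Cplus, Cmult; simpl; f_equal; ring).
  eapply Rle_trans; [apply Cmod_triangle|].
  rewrite Cmod_mult, Cmod_Ci, !Cmod_R. lra.
Qed.

Lemma im_le_Cmod (c : C) : Rabs (Im c) <= Cmod c.
Proof.
  eapply Rle_trans; [|apply Rmax_Cmod]. apply Rmax_r.
Qed.

(** The Cauchy-Riemann equations. *)
Lemma Cderiv_differentiable (f : C -> C) (x y A B : R) :
  Cderiv f (x, y) (A, B) ->
  differentiable_pt_lim (fun u v => Re (f (u, v))) x y A (- B) /\
  differentiable_pt_lim (fun u v => Im (f (u, v))) x y B A.
Proof.
  intros H. rewrite Cderiv_epsilon in H.
  assert (K : forall eps : posreal, exists d : posreal, forall u v,
     Rabs (u - x) < d -> Rabs (v - y) < d ->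
     Cmod (f (u, v) - f (x, y) - ((u, v) - (x, y)) * (A, B))%C
       <= eps * Rmax (Rabs (u - x)) (Rabs (v - y))).
  { intros eps. destruct (H (eps / 2)) as (d & Hd & Hw); [generalize (cond_pos eps); lra|].
    assert (Hd2 : 0 < d / 2) by lra.
    exists (mkposreal _ Hd2). simpl. intros u v Hu Hv.
    assert (E : Cmod ((u, v) - (x, y))%C <= Rabs (u - x) + Rabs (v - y))
      by apply (Cmod_le_abs (u - x) (v - y)).
    eapply Rle_trans; [apply Hw; lra|].
    generalize (Rmax_l (Rabs (u - x)) (Rabs (v - y))) (Rmax_r (Rabs (u - x)) (Rabs (v - y))).
    intros M1 M2. replace (eps * Rmax (Rabs (u - x)) (Rabs (v - y)))
      with (eps / 2 * (2 * Rmax (Rabs (u - x)) (Rabs (v - y)))) by field.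
    apply Rmult_le_compat_l; [generalize (cond_pos eps); lra | lra]. }
  split; intros eps; destruct (K eps) as [d Hd]; exists d; intros u v Hu Hv;
    (eapply Rle_trans; [|exact (Hd u v Hu Hv)]).
  - eapply Rle_trans; [|apply re_le_Cmod]. right. f_equal. simpl. unfold Re. ring.
  - eapply Rle_trans; [|apply im_le_Cmod]. right. f_equal. simpl. unfold Im. ring.
Qed.

Lemma differentiable_mult_sep (f g : R -> R) (x y lf lg : R) :
  is_derive f x lf -> is_derive g y lg ->
  differentiable_pt_lim (fun u v => f u * g v) x y (lf * g y) (f x * lg).
Proof.
  intros Hf Hg.
  assert (Hm : differentiable_pt_lim Rmult (f x) (g y) (g y) (f x)).
  { intros eps. exists eps. intros u v Hu Hv.
    replace (u * v - f x * g y - (g y * (u - f x) + f x * (v - g y)))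
      with ((u - f x) * (v - g y)) by ring.
    rewrite Rabs_mult. apply Rmult_le_compat; try apply Rabs_pos; [lra | apply Rmax_r]. }
  assert (Hu : differentiable_pt_lim (fun u _ => f u) x y lf 0)
    by now apply differentiable_pt_lim_proj1_0, is_derive_Reals.
  assert (Hv : differentiable_pt_lim (fun _ v => g v) x y 0 lg).
  { assert (Hs : differentiable_pt_lim (fun v _ => g v) y x lg 0)
      by now apply differentiable_pt_lim_proj1_0, is_derive_Reals.
    intros eps. destruct (Hs eps) as [d Hd]. exists d. intros u v H1 H2.
    specialize (Hd v u H2 H1). rewrite Rmax_comm.
    replace (0 * (u - x) + lg * (v - y)) with (lg * (v - y) + 0 * (u - x)) by ring.
    exact Hd. }
  generalize (differentiable_pt_lim_comp Rmult _ _ x y _ _ _ _ _ _ Hm Hu Hv).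
  replace (g y * lf + f x * 0) with (lf * g y) by ring.
  now replace (g y * 0 + f x * lg) with (f x * lg) by ring.
Qed.

(** The exponential of [s + i th], as a function of two real variables. *)
Definition polar (s th : R) : C := (exp s * cos th, exp s * sin th).

(** In logarithmic coordinates the field [(Re k, - Im k)] is again divergence-free, because the
    exponential is holomorphic. *)
Lemma Cderiv_polar (k : C -> C) (s th : R) (l : C) :
  Cderiv k (polar s th) l ->
  exists a b,
  differentiable_pt_lim (fun s th => Re (k (polar s th))) s th a (- b) /\
  differentiable_pt_lim (fun s th => - Im (k (polar s th))) s th (- b) (- a).
Proof.
  destruct l as [A B]. intros H. apply Cderiv_differentiable in H. destruct H as [HR HI].
  assert (Hx : differentiable_pt_lim (fun s th => exp s * cos th) s th
                 (exp s * cos th) (exp s * - sin th)).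
  { apply differentiable_mult_sep; [apply is_derive_exp | apply is_derive_cos]. }
  assert (Hy : differentiable_pt_lim (fun s th => exp s * sin th) s th
                 (exp s * sin th) (exp s * cos th)).
  { apply differentiable_mult_sep; [apply is_derive_exp | apply is_derive_sin]. }
  exists (A * (exp s * cos th) - B * (exp s * sin th)),
         (B * (exp s * cos th) + A * (exp s * sin th)).
  split.
  - generalize (differentiable_pt_lim_comp _ _ _ s th _ _ _ _ _ _ HR Hx Hy).
    match goal with |- differentiable_pt_lim _ _ _ ?a ?b -> differentiable_pt_lim _ _ _ ?c ?d =>
      replace c with a by ring; replace d with b by ring; exact (fun h => h) end.
  - assert (HI' : differentiable_pt_lim (fun u v => - Im (k (u, v)))
                    (exp s * cos th) (exp s * sin th) (- B) (- A)).
    { intros eps. destruct (HI eps) as [d Hd]. exists d. intros u v Hu Hv.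
      eapply Rle_trans; [|exact (Hd u v Hu Hv)]. right. rewrite <- Rabs_Ropp. f_equal. ring. }
    generalize (differentiable_pt_lim_comp _ _ _ s th _ _ _ _ _ _ HI' Hx Hy).
    match goal with |- differentiable_pt_lim _ _ _ ?a ?b -> differentiable_pt_lim _ _ _ ?c ?d =>
      replace c with a by ring; replace d with b by ring; exact (fun h => h) end.
Qed.

Lemma Cmod_polar s th : Cmod (polar s th) = exp s.
Proof.
  unfold Cmod, polar. simpl fst; simpl snd.
  replace ((exp s * cos th) ^ 2 + (exp s * sin th) ^ 2) with (exp s ^ 2).
  - apply sqrt_pow2, Rlt_le, exp_pos.
  - generalize (sin2_cos2 th). unfold Rsqr. intros E.
    transitivity (exp s ^ 2 * (sin th * sin th + cos th * cos th)); [rewrite E|]; ring.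
Qed.

Lemma exp_le_exp (x y : R) : x <= y -> exp x <= exp y.
Proof. intros [H | ->]; [apply Rlt_le, exp_increasing, H | apply Rle_refl]. Qed.

Lemma div_free_polar (k : C -> C) (a b : R) :
  (forall z, exp a <= Cmod z <= exp b -> exists l, Cderiv k z l) ->
  div_free_on (fun s th => Re (k (polar s th))) (fun s th => - Im (k (polar s th)))
    a b 0 (2 * PI).
Proof.
  intros H s th Hs Hth. destruct (H (polar s th)) as [l Hl].
  { rewrite Cmod_polar. split; apply exp_le_exp; lra. }
  destruct (Cderiv_polar k s th l Hl) as (p & q & Hp & Hq).
  exists p, (- q), (- q), (- p). repeat split; [exact Hp | exact Hq | ring].
Qed.

Lemma circle_mean_const (k : C -> C) (a b : R) :
  a <= b ->
  (forall z, exp a <= Cmod z <= exp b -> exists l, Cderiv k z l) ->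
  RInt (fun th => Re (k (polar a th))) 0 (2 * PI)
  = RInt (fun th => Re (k (polar b th))) 0 (2 * PI).
Proof.
  intros Hab H. generalize PI_RGT_0; intros Hpi.
  generalize (flux_div_free _ _ a b 0 (2 * PI) Hab ltac:(lra) (div_free_polar k a b H)).
  unfold flux.
  rewrite (RInt_ext (fun x => - Im (k (polar x (2 * PI)))) (fun x => - Im (k (polar x 0)))).
  - lra.
  - intros x _. unfold polar. now rewrite cos_2PI, sin_2PI, cos_0, sin_0.
Qed.

(** * Derivative at the centre of a function of nonnegative real part *)

(** With [z = rho * (cos th, sin th)], the integrand is the real part of
    [((a, b) + z * (p, q)) * (2 - z - / z)]; only the constant term of this Laurent polynomial
    has a nonzero mean. *)
Lemma circle_mean_main_term (rho a b p q : R) : rho <> 0 ->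
  is_RInt (fun th => (a + rho * (p * cos th - q * sin th)) *
                       (2 - rho * cos th - cos th / rho)
                     - (b + rho * (p * sin th + q * cos th)) *
                       (- rho * sin th + sin th / rho))
    0 (2 * PI) (2 * PI * (2 * a - p)).
Proof.
  intros Hr.
  (* An antiderivative of the integrand, once [sin th ^ 2 + cos th ^ 2] is replaced by [1]. *)
  set (G := fun th => (2 * a - p) * th
     + rho * ((2 * p - a) * sin th + (2 * q - b) * cos th)
     - / rho * (a * sin th - b * cos th)
     - rho ^ 2 * (p * (sin th * cos th) - q * (sin th) ^ 2)).
  replace (2 * PI * (2 * a - p)) with (minus (G (2 * PI)) (G 0)).
  2:{ unfold G, minus, plus, opp; simpl. rewrite cos_2PI, sin_2PI, cos_0, sin_0. ring. }
  apply (is_RInt_derive (V := R_CompleteNormedModule)).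
  - intros t _. unfold G. auto_derive; [trivial|].
    generalize (sin2_cos2 t). unfold Rsqr. intros E.
    (* The sum of squares is put back, so that the identity becomes polynomial. *)
    transitivity ((2 * a - p * (sin t * sin t + cos t * cos t))
      + rho * ((2 * p - a) * cos t - (2 * q - b) * sin t)
      - / rho * (a * cos t + b * sin t)
      - rho ^ 2 * (p * (cos t * cos t - sin t * sin t) - 2 * q * (sin t * cos t))).
    + rewrite E. ring.
    + field. exact Hr.
  - intros t _. apply continuity_pt_filterlim, derivable_continuous_pt.
    apply ex_derive_Reals_0. auto_derive. repeat split; exact Hr.
Qed.

Lemma polar_neq_0 s th : polar s th <> 0%C.
Proof. apply Cmod_gt_0. rewrite Cmod_polar. apply exp_pos. Qed.

Lemma polar_inv s th : (/ polar s th)%C = ((cos th / exp s)%R, (- (sin th / exp s))%R).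
Proof.
  assert (He := exp_pos s).
  assert (E : (polar s th * ((cos th / exp s)%R, (- (sin th / exp s))%R))%C = 1%C).
  { unfold polar, Cmult, RtoC; simpl. generalize (sin2_cos2 th). unfold Rsqr. intros E.
    f_equal; [|field; lra].
    transitivity (sin th * sin th + cos th * cos th); [field; lra | exact E]. }
  transitivity (/ polar s th * (polar s th * ((cos th / exp s)%R, (- (sin th / exp s))%R)))%C.
  - now rewrite E, Cmult_1_r.
  - field. apply polar_neq_0.
Qed.

(** If [f] is holomorphic at each point of the closed unit disc, the mean over the unit circle
    of the real part of [k z = f z * (2 - z - / z)] is nonnegative. It is also the mean over a
    small circle, which tends to [Re (2 * f 0 - l)]. *)
Lemma deriv_le_of_Re_nonneg (f : C -> C) (l : C) :
  (forall z, Cmod z <= 1 -> exists m, Cderiv f z m) ->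
  (forall z, Cmod z <= 1 -> 0 <= Re (f z)) ->
  Cderiv f 0%C l ->
  Re l <= 2 * Re (f 0%C).
Proof.
  intros Hf Hre Hl.
  set (k := fun z => (f z * (2 - z - / z))%C).
  assert (Hk : forall a z, exp a <= Cmod z <= exp 0 -> exists m, Cderiv k z m).
  { intros a z [H1 H2]. rewrite exp_0 in H2. destruct (Hf z H2) as [m Hm].
    assert (Hz : z <> 0%C) by (apply Cmod_gt_0; generalize (exp_pos a); lra).
    eexists. unfold k. apply Cderiv_mult; [exact Hm|].
    apply Cderiv_minus; [apply Cderiv_minus; [apply Cderiv_const | apply Cderiv_id]|].
    now apply Cderiv_inv. }
  assert (HI : forall s a, s <= 0 -> a < s -> ex_RInt (fun th => Re (k (polar s th))) 0 (2 * PI)).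
  { intros s a Hs Ha. generalize PI_RGT_0; intros Hpi.
    apply (div_free_ex_RInt_fst (fun s th => Re (k (polar s th)))
        (fun s th => - Im (k (polar s th))) a 0 0 (2 * PI)); try lra.
    apply div_free_polar. apply Hk. }
  assert (Hpos : 0 <= RInt (fun th => Re (k (polar 0 th))) 0 (2 * PI)).
  { generalize PI_RGT_0; intros Hpi.
    apply RInt_ge_0; [lra | apply (HI 0 (-1)); lra |]. intros th _.
    unfold k. 
    (* On the unit circle the kernel is real and nonnegative. *)
    replace (2 - polar 0 th - / polar 0 th)%C with (RtoC (2 * (1 - cos th))).
    - replace (Re (f (polar 0 th) * RtoC (2 * (1 - cos th)))%C)
        with (2 * ((1 - cos th) * Re (f (polar 0 th)))) by (unfold Re; simpl; ring).
      generalize (COS_bound th); intros Hc.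
      apply Rmult_le_pos; [lra|]. apply Rmult_le_pos; [lra|]. apply Hre.
      rewrite Cmod_polar, exp_0. lra.
    - rewrite polar_inv. unfold polar. rewrite exp_0.
      unfold RtoC, Cminus, Cplus, Copp; simpl. f_equal; field. }
  apply le_epsilon. intros eps Heps.
  rewrite Cderiv_epsilon in Hl.
  (* For [rho <= 1], [rho * (2 + rho + / rho) <= 4], whence [eps / 4]. *)
  destruct (Hl (eps / 4) ltac:(lra)) as (d & Hd & Hw).
  set (rho := Rmin (d / 2) (1 / 2)).
  assert (Hrho : 0 < rho) by (apply Rmin_pos; lra).
  assert (Hrd : rho < d) by (unfold rho; generalize (Rmin_l (d / 2) (1 / 2)); lra).
  assert (Hr1 : rho < 1) by (unfold rho; generalize (Rmin_r (d / 2) (1 / 2)); lra).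
  set (s := ln rho).
  assert (Es : exp s = rho) by (apply exp_ln; assumption).
  assert (Hs : s < 0) by (unfold s; rewrite <- ln_1; apply ln_increasing; assumption).
  rewrite <- (circle_mean_const k s 0) in Hpos by (lra || apply Hk).
  destruct l as [p q]. destruct (f 0%C) as [a b].
  generalize (circle_mean_main_term rho a b p q ltac:(lra)). intros HT.
  assert (Hle : RInt (fun th => Re (k (polar s th))) 0 (2 * PI)
                <= 2 * PI * (2 * a - p) + 2 * PI * eps).
  { generalize PI_RGT_0; intros Hpi.
    match type of HT with is_RInt ?g _ _ _ => set (T := g) in HT end.
    assert (HT2 : is_RInt (fun th => T th + eps) 0 (2 * PI)
                    (2 * PI * (2 * a - p) + (2 * PI - 0) * eps)).
    { exact (is_RInt_plus (V := R_NormedModule) _ _ _ _ _ _ HT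
               (is_RInt_const (V := R_NormedModule) 0 (2 * PI) eps)). }
    rewrite Rminus_0_r in HT2. rewrite <- (is_RInt_unique _ _ _ _ HT2).
    apply RInt_le; [lra | apply (HI s (s - 1)); lra | eexists; exact HT2 |].
    intros th _. unfold T.
    set (z := polar s th).
    assert (Ez : Cmod z = rho) by (unfold z; rewrite Cmod_polar; exact Es).
    assert (Hwz := Hw z). replace (z - 0)%C with z in Hwz by ring.
    rewrite Ez in Hwz. specialize (Hwz Hrd).
    set (err := (f z - (a, b) - z * (p, q))%C) in Hwz.
    replace (k z) with (((a, b) + z * (p, q)) * (2 - z - / z) + err * (2 - z - / z))%C
      by (unfold k, err; ring).
    assert (Herr : Re (err * (2 - z - / z))%C <= eps).
    { eapply Rle_trans; [apply Rle_abs|]. eapply Rle_trans; [apply re_le_Cmod|].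
      rewrite Cmod_mult.
      assert (Hk4 : Cmod (2 - z - / z)%C <= 2 + rho + / rho).
      { eapply Rle_trans; [apply Cmod_triangle|].
        rewrite Cmod_opp, Cmod_inv, Ez by apply polar_neq_0.
        generalize (Cmod_triangle 2 (- z)). rewrite Cmod_opp, Ez, Cmod_R, Rabs_pos_eq by lra.
        unfold Cminus. lra. }
      apply Rle_trans with (eps / 4 * rho * (2 + rho + / rho)).
      - apply Rmult_le_compat; (apply Cmod_ge_0 || assumption).
      - replace (eps / 4 * rho * (2 + rho + / rho))
          with (eps / 4 * (2 * rho + rho * rho + 1)) by (field; lra).
        assert (rho * rho <= 1) by nra. nra. }
    replace (Re (((a, b) + z * (p, q)) * (2 - z - / z) + err * (2 - z - / z))%C)
      with (Re (((a, b) + z * (p, q)) * (2 - z - / z))%C + Re (err * (2 - z - / z))%C)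
      by reflexivity.
    apply Rplus_le_compat; [|exact Herr]. right.
    unfold z. rewrite polar_inv. unfold polar. rewrite Es.
    unfold Re, RtoC, Cminus, Cplus, Copp, Cmult; simpl. field. lra. }
  generalize PI_RGT_0; intros Hpi. simpl.
  assert (0 <= 2 * PI * (2 * a - p + eps)) by lra.
  assert (0 <= 2 * a - p + eps); [|lra].
  apply Rmult_le_reg_l with (2 * PI); lra.
Qed.


(** The same for a function on the open disc, applied to [f (r * z)] with [r] tending to [1]. *)
Lemma deriv_le_of_Re_nonneg_disc (f : C -> C) (l : C) :
  (forall z, Cmod z < 1 -> exists m, Cderiv f z m) ->
  (forall z, Cmod z < 1 -> 0 <= Re (f z)) ->
  Cderiv f 0%C l ->
  Re l <= 2 * Re (f 0%C).
Proof.
  intros Hf Hre Hl.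
  assert (K : forall r, 0 < r < 1 -> r * Re l <= 2 * Re (f 0%C)).
  { intros r Hr.
    assert (Hs : forall z, Cmod z <= 1 -> Cmod (RtoC r * z)%C < 1).
    { intros z Hz. rewrite Cmod_mult, Cmod_R, Rabs_pos_eq by lra.
      generalize (Cmod_ge_0 z). nra. }
    assert (Hd : forall z m, Cderiv f (RtoC r * z)%C m ->
              Cderiv (fun w => f (RtoC r * w)%C) z (RtoC r * m)%C).
    { intros z m Hm. apply (Cderiv_comp f (fun w => RtoC r * w)%C); [exact Hm|].
      eapply Cderiv_eq; [apply Cderiv_mult; [apply Cderiv_const | apply Cderiv_id]|]. cbv beta. ring. }
    generalize (deriv_le_of_Re_nonneg (fun w => f (RtoC r * w)%C) (RtoC r * l)%C).
    cbv beta. rewrite Cmult_0_r. intros H.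
    replace (r * Re l) with (Re (RtoC r * l)%C) by (unfold Re; simpl; ring).
    apply H.
    - intros z Hz. destruct (Hf _ (Hs z Hz)) as [m Hm]. eexists. now apply Hd, Hm.
    - intros z Hz. now apply Hre, Hs.
    - apply Hd. now rewrite Cmult_0_r. }
  destruct (Rle_lt_dec (Re l) (2 * Re (f 0%C))) as [|H]; [assumption|exfalso].
  assert (H0 : 0 <= Re (f 0%C)) by (apply Hre; rewrite Cmod_0; lra).
  set (A := 2 * Re (f 0%C)) in *. set (L := Re l) in *.
  (* This [r] gives [r * L = (A + L) / 2], which exceeds [A]. *)
  specialize (K ((A + L) / (2 * L))).
  assert (HL : 0 < L) by (unfold A in *; lra).
  assert (Hr : 0 < (A + L) / (2 * L) < 1).
  { split; [apply Rdiv_lt_0_compat; unfold A in *; lra|].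
    apply Rlt_div_l; lra. }
  specialize (K Hr).
  replace ((A + L) / (2 * L) * L) with ((A + L) / 2) in K by (field; lra). lra.
Qed.

(** * Harnack's inequality and invariance of the horodisc *)

Lemma Cderiv_real_line (g : C -> C) (s : R) (l : C) :
  Cderiv g (RtoC s) l -> is_derive (fun u => Re (g (RtoC u))) s (Re l).
Proof.
  destruct l as [A B]. intros H. apply Cderiv_differentiable in H as [H _].
  apply is_derive_Reals.
  replace (Re (A, B)) with (A * 1 + - B * 0) by (simpl; ring).
  apply (derivable_pt_lim_comp_2d (fun u v => Re (g (u, v))) (fun u => u) (fun _ => 0)).
  - exact H.
  - apply derivable_pt_lim_id.
  - apply derivable_pt_lim_const.
Qed.

Lemma Cmod_lt_of_sq (a b : C) : Cmod a ^ 2 < Cmod b ^ 2 -> Cmod a < Cmod b.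
Proof. intros H. generalize (Cmod_ge_0 a) (Cmod_ge_0 b). nra. Qed.

Lemma Cmod_sq_fst_snd (z : C) : Cmod z ^ 2 = fst z ^ 2 + snd z ^ 2.
Proof. apply Cmod2_alt. Qed.

Lemma one_plus_mult_neq_0 (s : R) (z : C) :
  0 <= s < 1 -> Cmod z < 1 -> (1 + RtoC s * z)%C <> 0%C.
Proof.
  intros Hs Hz. apply Cmod_gt_0.
  generalize (Cmod_minus_rev 1 (- (RtoC s * z))).
  rewrite Cmod_opp, Cmod_mult, Cmod_1, Cmod_R, Rabs_pos_eq by lra.
  replace (1 - - (RtoC s * z))%C with (1 + RtoC s * z)%C by ring.
  generalize (Cmod_ge_0 z). nra.
Qed.

Lemma Cmod_translate_lt_1 (s : R) (z : C) :
  0 <= s < 1 -> Cmod z < 1 -> Cmod ((RtoC s + z) / (1 + RtoC s * z))%C < 1.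
Proof.
  intros Hs Hz.
  assert (Hn := one_plus_mult_neq_0 s z Hs Hz).
  rewrite Cmod_div by assumption.
  apply Rlt_div_l; [now apply Cmod_gt_0|]. rewrite Rmult_1_l.
  apply Cmod_lt_of_sq.
  assert (Hz2 : Cmod z ^ 2 < 1) by (generalize (Cmod_ge_0 z); nra).
  rewrite !Cmod_sq_fst_snd in *. destruct z as [x y]. simpl in *.
  assert (0 < (1 - s * s) * (1 - (x * x + y * y))) by (apply Rmult_lt_0_compat; nra).
  nra.
Qed.

(** The inequality at the centre, applied to [p] composed with the disc automorphism
    [T z = eta * ((s + z) / (1 + s * z))], which sends [0] to [eta * s] and has derivative
    [eta * (1 - s ^ 2)] at [0]. *)
Lemma radial_deriv_le (p : C -> C) (eta : C) (s : R) (l : C) :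
  (forall z, Cmod z < 1 -> exists m, Cderiv p z m) ->
  (forall z, Cmod z < 1 -> 0 <= Re (p z)) ->
  Cmod eta = 1 -> 0 <= s < 1 ->
  Cderiv p (eta * RtoC s)%C l ->
  (1 - s ^ 2) * Re (eta * l)%C <= 2 * Re (p (eta * RtoC s)%C).
Proof.
  intros Hp Hre Heta Hs Hl.
  set (T := fun z => (eta * ((RtoC s + z) / (1 + RtoC s * z)))%C).
  assert (HT : forall z, Cmod z < 1 -> Cmod (T z) < 1).
  { intros z Hz. unfold T. rewrite Cmod_mult, Heta, Rmult_1_l.
    now apply Cmod_translate_lt_1. }
  assert (HT' : forall z, Cmod z < 1 -> Cderiv T z
            (eta * ((1 - RtoC s * RtoC s) / ((1 + RtoC s * z) * (1 + RtoC s * z))))%C).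
  { intros z Hz. assert (Hn := one_plus_mult_neq_0 s z Hs Hz).
    eapply Cderiv_eq.
    - apply Cderiv_mult; [apply Cderiv_const|].
      apply Cderiv_div; [exact Hn | |].
      + apply Cderiv_plus; [apply Cderiv_const | apply Cderiv_id].
      + apply Cderiv_plus; [apply Cderiv_const|].
        apply Cderiv_mult; [apply Cderiv_const | apply Cderiv_id].
    - cbv beta. field. exact Hn. }
  assert (ET0 : T 0%C = (eta * RtoC s)%C).
  { unfold T. field. }
  assert (H0 : Cmod 0 < 1) by (rewrite Cmod_0; lra).
  generalize (deriv_le_of_Re_nonneg_disc (fun z => p (T z))
    (eta * ((1 - RtoC s * RtoC s) / ((1 + RtoC s * 0) * (1 + RtoC s * 0))) * l)%C).
  cbv beta. rewrite ET0. intros H.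
  replace ((1 - s ^ 2) * Re (eta * l)%C) with
    (Re (eta * ((1 - RtoC s * RtoC s) / ((1 + RtoC s * 0) * (1 + RtoC s * 0))) * l)%C).
  - apply H.
    + intros z Hz. destruct (Hp (T z) (HT z Hz)) as [m Hm]. eexists.
      apply (Cderiv_comp p T); [exact Hm | now apply HT'].
    + intros z Hz. apply Hre, HT, Hz.
    + apply (Cderiv_comp p T); [rewrite ET0; exact Hl | now apply HT'].
  - replace (eta * ((1 - RtoC s * RtoC s) / ((1 + RtoC s * 0) * (1 + RtoC s * 0))) * l)%C
      with (RtoC (1 - s ^ 2) * (eta * l))%C.
    + unfold Re; simpl; ring.
    + rewrite Cmult_0_r, Cplus_0_r, Cmult_1_r, RtoC_minus, RtoC_pow. simpl. field.
Qed.

(** Along the radius through [a], the function [V s = (1 - s) / (1 + s) * Re (p (eta * s))] is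
    nonincreasing, since [U s = Re (p (eta * s))] satisfies [(1 - s ^ 2) * U' s <= 2 * U s]. *)
Lemma harnack (p : C -> C) (a : C) :
  (forall z, Cmod z < 1 -> exists m, Cderiv p z m) ->
  (forall z, Cmod z < 1 -> 0 <= Re (p z)) ->
  Cmod a < 1 ->
  (1 - Cmod a) * Re (p a) <= (1 + Cmod a) * Re (p 0%C).
Proof.
  intros Hp Hre Ha.
  destruct (Req_dec (Cmod a) 0) as [E0|Hne].
  { rewrite (Cmod_eq_0 a E0), Cmod_0. lra. }
  assert (Ha0 : 0 < Cmod a) by (generalize (Cmod_ge_0 a); lra).
  set (r := Cmod a) in *.
  assert (Hr : RtoC r <> 0%C) by (intros E; apply RtoC_inj in E; lra).
  set (eta := (a / RtoC r)%C).
  assert (Heta : Cmod eta = 1).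
  { unfold eta. rewrite Cmod_div by assumption. rewrite Cmod_R, Rabs_pos_eq by lra.
    fold r. field. lra. }
  assert (Ea : a = (eta * RtoC r)%C) by (unfold eta; field; assumption).
  assert (Hin : forall s, 0 <= s < 1 -> Cmod (eta * RtoC s)%C < 1).
  { intros s Hs. rewrite Cmod_mult, Heta, Cmod_R, Rabs_pos_eq by lra. lra. }
  set (V := fun s => (1 - s) / (1 + s) * Re (p (eta * RtoC s)%C)).
  assert (HV : forall s, 0 <= s < 1 -> exists v, is_derive V s v /\ v <= 0).
  { intros s Hs. destruct (Hp _ (Hin s Hs)) as [l Hl].
    assert (HU : is_derive (fun u => Re (p (eta * RtoC u)%C)) s (Re (eta * l)%C)).
    { apply (Cderiv_real_line (fun w => p (eta * w)%C)).
      apply (Cderiv_comp p (fun w => (eta * w)%C)); [exact Hl|].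
      eapply Cderiv_eq; [apply Cderiv_mult; [apply Cderiv_const | apply Cderiv_id]|].
      cbv beta. ring. }
    assert (Hq : is_derive (fun u => (1 - u) / (1 + u)) s (- 2 / (1 + s) ^ 2)).
    { auto_derive; [lra|]. field. lra. }
    eexists. split.
    - apply (is_derive_mult (K := R_AbsRing) _ _ _ _ _ Hq HU). exact Rmult_comm.
    - generalize (radial_deriv_le p eta s l Hp Hre Heta Hs Hl). intros H.
      set (U := Re (p (eta * RtoC s)%C)) in *. set (U' := Re (eta * l)%C) in *.
      change (-2 / (1 + s) ^ 2 * U + (1 - s) / (1 + s) * U' <= 0).
      replace (-2 / (1 + s) ^ 2 * U + (1 - s) / (1 + s) * U')
        with (((1 - s ^ 2) * U' - 2 * U) * / (1 + s) ^ 2) by (field; lra).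
      assert (0 < / (1 + s) ^ 2) by (apply Rinv_0_lt_compat, pow_lt; lra).
      nra. }
  destruct (MVT_gen V 0 r (Derive V)) as [c [Hc E]].
  - rewrite Rmin_left, Rmax_right by lra. intros x Hx.
    destruct (HV x ltac:(lra)) as [v [H1 _]]. apply Derive_correct. now exists v.
  - rewrite Rmin_left, Rmax_right by lra. intros x Hx.
    destruct (HV x ltac:(lra)) as [v [H1 _]].
    apply continuity_pt_filterlim. apply (ex_derive_continuous (V := R_NormedModule)).
    now exists v.
  - rewrite Rmin_left, Rmax_right in Hc by lra.
    destruct (HV c ltac:(lra)) as [v [H1 H2]].
    rewrite (is_derive_unique _ _ _ H1) in E.
    assert (HVle : V r <= V 0) by nra.
    unfold V in HVle. rewrite <- Ea, Cmult_0_r in HVle.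
    replace ((1 - 0) / (1 + 0) * Re (p 0%C)) with (Re (p 0%C)) in HVle by field.
    replace ((1 - r) * Re (p a)) with ((1 + r) * ((1 - r) / (1 + r) * Re (p a))) by (field; lra).
    apply Rmult_le_compat_l; lra.
Qed.

Lemma Re_cayley (sg w : C) : Cmod sg = 1 -> sg <> w ->
  Re ((sg + w) / (sg - w))%C = (1 - Cmod w ^ 2) / Cmod (sg - w)%C ^ 2.
Proof.
  intros Hs Hn.
  assert (H0 : (sg - w)%C <> 0%C).
  { intros E. apply Hn. replace sg with (sg - w + w)%C by ring. rewrite E. ring. }
  assert (Hm : 0 < Cmod (sg - w)%C ^ 2) by (apply pow_lt; now apply Cmod_gt_0).
  assert (Hs2 : Cmod sg ^ 2 = 1) by (rewrite Hs; ring).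
  rewrite <- Hs2. rewrite !Cmod_sq_fst_snd in *.
  destruct sg as [a b], w as [x y]. unfold Re. simpl in *. field. lra.
Qed.

(** Julia's inequality in finite form: a point [a] that [f] does not bring nearer to the
    origin constrains [f 0] to the horodisc through [0] at the radial projection of [f a] to the
    unit circle. *)
Lemma julia_step (f : C -> C) (a : C) :
  (forall z, Cmod z < 1 -> exists m, Cderiv f z m) ->
  (forall z, Cmod z < 1 -> Cmod (f z) < 1) ->
  Cmod a < 1 -> Cmod a <= Cmod (f a) -> f a <> 0%C ->
  Cmod (f a / RtoC (Cmod (f a)) - f 0)%C ^ 2 <= 1 - Cmod (f 0%C) ^ 2.
Proof.
  intros Hf Hself Ha Hle Hne.
  set (r := Cmod (f a)) in *.
  assert (Hr : 0 < r) by now apply Cmod_gt_0.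
  assert (Hr1 : r < 1) by now apply Hself.
  assert (Hr0 : RtoC r <> 0%C) by (intros E; apply RtoC_inj in E; lra).
  set (sg := (f a / RtoC r)%C).
  assert (Hsg : Cmod sg = 1).
  { unfold sg. rewrite Cmod_div by assumption. rewrite Cmod_R, Rabs_pos_eq by lra.
    fold r. field. lra. }
  assert (Efa : f a = (sg * RtoC r)%C) by (unfold sg; field; assumption).
  assert (Hneq : forall z, Cmod z < 1 -> sg <> f z).
  { intros z Hz E. generalize (Hself z Hz). rewrite <- E. lra. }
  assert (Hdiff : forall z, Cmod z < 1 -> (sg - f z)%C <> 0%C).
  { intros z Hz E. apply (Hneq z Hz). replace sg with (sg - f z + f z)%C by ring.
    rewrite E. ring. }
  set (p := fun z => ((sg + f z) / (sg - f z))%C).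
  assert (H0 : Cmod 0 < 1) by (rewrite Cmod_0; lra).
  assert (HH : (1 - Cmod a) * Re (p a) <= (1 + Cmod a) * Re (p 0%C)).
  { apply harnack; [| |exact Ha].
    - intros z Hz. destruct (Hf z Hz) as [m Hm]. eexists. unfold p.
      apply Cderiv_div; [now apply Hdiff | |].
      + apply Cderiv_plus; [apply Cderiv_const | exact Hm].
      + apply Cderiv_minus; [apply Cderiv_const | exact Hm].
    - intros z Hz. unfold p. rewrite Re_cayley by auto.
      apply Rlt_le, Rdiv_lt_0_compat.
      + generalize (Hself z Hz) (Cmod_ge_0 (f z)). nra.
      + apply pow_lt, Cmod_gt_0, Hdiff, Hz. }
  unfold p in HH. rewrite !Re_cayley in HH by auto.
  assert (E1 : Cmod (sg - f a)%C = 1 - r).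
  { rewrite Efa. replace (sg - sg * RtoC r)%C with (sg * RtoC (1 - r))%C
      by (rewrite RtoC_minus; ring).
    rewrite Cmod_mult, Hsg, Cmod_R, Rabs_pos_eq; lra. }
  rewrite E1 in HH. fold r in HH.
  assert (HD : 0 < Cmod (sg - f 0)%C) by now apply Cmod_gt_0, Hdiff.
  set (D := Cmod (sg - f 0)%C) in *. set (N := 1 - Cmod (f 0%C) ^ 2) in *.
  replace ((1 - r ^ 2) / (1 - r) ^ 2) with ((1 + r) / (1 - r)) in HH by (field; lra).
  set (ra := Cmod a) in *.
  assert (HD2 : 0 < D ^ 2) by now apply pow_lt.
  assert (H1 : (1 + ra) * 1 <= (1 - ra) * ((1 + r) / (1 - r))).
  { replace ((1 - ra) * ((1 + r) / (1 - r))) with ((1 - ra) * (1 + r) / (1 - r)) by (field; lra).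
    apply (Rle_div_r ((1 + ra) * 1) ((1 - ra) * (1 + r)) (1 - r)); nra. }
  assert (Hra : 0 <= ra) by apply Cmod_ge_0.
  assert (H2 : 1 <= N / D ^ 2) by (apply Rmult_le_reg_l with (1 + ra); lra).
  apply Rle_div_r in H2; lra.
Qed.

Lemma frequently_nondecreasing (u : nat -> R) :
  (forall n, u n < 1) -> (forall eps, 0 < eps -> exists N, forall n, (N <= n)%nat -> 1 - eps < u n) ->
  forall N, exists n, (N <= n)%nat /\ u n <= u (S n).
Proof.
  intros Hu Hlim N.
  destruct (classic (exists n, (N <= n)%nat /\ u n <= u (S n))) as [|H]; [assumption|exfalso].
  assert (Hdec : forall k, u (N + k)%nat <= u N).
  { induction k as [|k IH]; [rewrite Nat.add_0_r; lra|].
    rewrite Nat.add_succ_r. destruct (Rle_lt_dec (u (N + k)%nat) (u (S (N + k)))) as [h|h]; [|lra].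
    exfalso. apply H. exists (N + k)%nat. split; [lia | exact h]. }
  destruct (Hlim (1 - u N)) as [M HM]; [generalize (Hu N); lra|].
  generalize (HM (N + M)%nat ltac:(lia)) (Hdec M). lra.
Qed.

(** The points [phi t 0] lie in the closed horodisc at [tau] whose boundary contains [0]. *)
Lemma horodisc_invariance (phi : R -> C -> C) (tau : C) (t : R) :
  nonelliptic_semigroup phi -> denjoy_wolff_point phi tau -> 0 <= t ->
  Cmod (tau - phi t 0)%C ^ 2 <= 1 - Cmod (phi t 0%C) ^ 2.
Proof.
  intros Hphi [Htau Hlim] Ht.
  assert (H0 : unit_disc 0%C) by (unfold unit_disc; rewrite Cmod_0; lra).
  (* The orbit along the multiples of [t] tends to [tau] only when [t] is positive. *)
  destruct (Req_dec t 0) as [->|Hne].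
  { rewrite (nes_id _ Hphi) by assumption. replace (tau - 0)%C with tau by ring.
    rewrite Htau, Cmod_0. lra. }
  assert (Htp : 0 < t) by lra.
  set (z := fun n : nat => phi (INR n * t) 0%C).
  assert (Hnt : forall n, 0 <= INR n * t) by (intros n; apply Rmult_le_pos; [apply pos_INR | lra]).
  assert (Hz : forall n, Cmod (z n) < 1) by (intros n; now apply (nes_self _ Hphi)).
  assert (HzS : forall n, z (S n) = phi t (z n)).
  { intros n. unfold z. rewrite <- (nes_add _ Hphi) by auto. f_equal. rewrite S_INR. ring. }
  assert (Hconv : forall eps, 0 < eps -> exists N, forall n, (N <= n)%nat -> Cmod (tau - z n)%C < eps).
  { intros eps He.
    assert (Hball : locally tau (fun w => Cmod (tau - w)%C < eps)).
    { exists (mkposreal (eps / 2) ltac:(lra)). intros w [Hw1 Hw2].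
      change (Rabs (fst w - fst tau) < eps / 2) in Hw1.
      change (Rabs (snd w - snd tau) < eps / 2) in Hw2.
      replace (tau - w)%C with (- (w - tau))%C by ring. rewrite Cmod_opp.
      eapply Rle_lt_trans; [apply (Cmod_le_abs (fst w - fst tau) (snd w - snd tau))|]. lra. }
    destruct (Hlim 0%C H0 _ Hball) as [M HM].
    destruct (INR_unbounded (M / t)) as [N HN].
    exists N. intros n Hn. apply HM.
    apply Rlt_div_l in HN; [|assumption].
    apply le_INR in Hn. nra. }
  assert (Hmod : forall eps, 0 < eps -> exists N, forall n, (N <= n)%nat -> 1 - eps < Cmod (z n)).
  { intros eps He. destruct (Hconv eps He) as [N HN]. exists N. intros n Hn.
    generalize (HN n Hn) (Cmod_minus_rev tau (z n)). lra. }
  set (f0 := phi t 0%C).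
  assert (Hf0 : Cmod f0 < 1) by now apply (nes_self _ Hphi).
  assert (Hsq : 0 <= 1 - Cmod f0 ^ 2) by (generalize (Cmod_ge_0 f0); nra).
  set (R0 := sqrt (1 - Cmod f0 ^ 2)).
  assert (HR0 : R0 ^ 2 = 1 - Cmod f0 ^ 2) by (unfold R0; rewrite <- Rsqr_pow2; now apply Rsqr_sqrt).
  assert (HR0p : 0 <= R0) by apply sqrt_pos.
  assert (Hle : Cmod (tau - f0)%C <= R0).
  { apply le_epsilon. intros eps He.
    (* The radial projection of [w = z (n + 1)] to the circle is at distance
       [1 - Cmod w <= Cmod (tau - w)] from [w], so that each of the two distances may be [eps / 2];
       the bound [1] keeps [w] away from [0]. *)
    destruct (Hconv (Rmin (eps / 2) 1)) as [N HN]; [apply Rmin_pos; lra|].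
    destruct (frequently_nondecreasing (fun n => Cmod (z n)) Hz Hmod N) as (n & Hn & Hinc).
    specialize (HN (S n) ltac:(lia)).
    assert (Hc1 : Cmod (tau - z (S n))%C < eps / 2) by (generalize (Rmin_l (eps / 2) 1); lra).
    assert (Hc2 : Cmod (tau - z (S n))%C < 1) by (generalize (Rmin_r (eps / 2) 1); lra).
    generalize (Cmod_minus_rev tau (z (S n))). rewrite Htau. intros Hd.
    rewrite HzS in *. set (w := phi t (z n)) in *.
    assert (Hw0 : 0 < Cmod w) by lra.
    assert (Hwne : w <> 0%C) by now apply Cmod_gt_0.
    assert (Hr0 : RtoC (Cmod w) <> 0%C) by (intros E; apply RtoC_inj in E; lra).
    assert (HJ := julia_step (phi t) (z n)).
    fold w in HJ. fold f0 in HJ.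
    assert (HJ' : Cmod (w / RtoC (Cmod w) - f0)%C <= R0).
    { assert (Cmod (w / RtoC (Cmod w) - f0)%C ^ 2 <= R0 ^ 2).
      { rewrite HR0. apply HJ; auto.
        - intros y Hy. apply Cderiv_of_ex_derive. now apply (nes_holo _ Hphi).
        - intros y Hy. now apply (nes_self _ Hphi). }
      generalize (Cmod_ge_0 (w / RtoC (Cmod w) - f0)%C). nra. }
    assert (Hsw : Cmod (w - w / RtoC (Cmod w))%C = 1 - Cmod w).
    { replace (w - w / RtoC (Cmod w))%C with (w / RtoC (Cmod w) * RtoC (Cmod w - 1))%C
        by (rewrite RtoC_minus; field; assumption).
      rewrite Cmod_mult, Cmod_div, !Cmod_R by assumption.
      rewrite (Rabs_pos_eq (Cmod w)) by lra.
      assert (Cmod w < 1) by (unfold w; rewrite <- HzS; apply Hz).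
      rewrite Rabs_left by lra. field. lra. }
    replace (tau - f0)%C with ((tau - w) + ((w - w / RtoC (Cmod w)) + (w / RtoC (Cmod w) - f0)))%C by ring.
    eapply Rle_trans; [apply Cmod_triangle|].
    generalize (Cmod_triangle (w - w / RtoC (Cmod w)) (w / RtoC (Cmod w) - f0)). lra. }
  rewrite <- HR0. generalize (Cmod_ge_0 (tau - f0)%C). fold f0. nra.
Qed.

(** * Projection onto the geodesic *)

Lemma ln_ratio_le (a b : R) : 0 <= a < 1 -> 0 <= b < 1 ->
  (/ 2 * ln ((1 + a) / (1 - a)) <= / 2 * ln ((1 + b) / (1 - b)) <-> a <= b).
Proof.
  intros Ha Hb.
  assert (Hpos : forall c, 0 <= c < 1 -> 0 < (1 + c) / (1 - c))
    by (intros c Hc; apply Rdiv_lt_0_compat; lra).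
  assert (Hfrac : forall c d, 0 <= c -> c < d -> d < 1 -> (1 + c) / (1 - c) < (1 + d) / (1 - d)).
  { intros c d Hc Hcd Hd.
    apply Rlt_div_l; [lra|].
    replace ((1 + d) / (1 - d) * (1 - c)) with ((1 + d) * (1 - c) / (1 - d)) by (field; lra).
    apply (Rlt_div_r (1 + c) ((1 + d) * (1 - c)) (1 - d)); nra. }
  split; intros H.
  - destruct (Rle_lt_dec a b) as [|h]; [assumption|exfalso].
    assert (ln ((1 + b) / (1 - b)) < ln ((1 + a) / (1 - a)))
      by (apply ln_increasing; [now apply Hpos | now apply Hfrac]).
    lra.
  - destruct H as [h | ->]; [|lra].
    assert (ln ((1 + a) / (1 - a)) < ln ((1 + b) / (1 - b)))
      by (apply ln_increasing; [now apply Hpos | now apply Hfrac]).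
    lra.
Qed.


(** In the half-plane, with [w = (tau + z) / (tau - z)] and [s = (1 + r) / (1 - r)] the image of
    [r * tau], this is [Cmod (tau - z) ^ 2 * Cmod (w + s) ^ 2 / s]. As a function of [r] it
    increases with the distance from [z] to [r * tau]. *)
Definition stretch (tau z : C) (r : R) : R :=
  Cmod (tau - z)%C ^ 2 * ((1 + r) / (1 - r)) + Cmod (tau + z)%C ^ 2 * ((1 - r) / (1 + r))
  + 2 * (1 - Cmod z ^ 2).

Lemma Cmod_disc_aut_geodesic (tau z : C) (r : R) :
  Cmod tau = 1 -> Cmod z < 1 -> -1 < r < 1 ->
  0 < stretch tau z r /\
  Cmod (disc_aut z (radial_geodesic tau r)) ^ 2
  = 1 - 4 * (1 - Cmod z ^ 2) / stretch tau z r.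
Proof.
  intros Htau Hz Hr.
  set (w := radial_geodesic tau r).
  assert (Hw : Cmod w = Rabs r)
    by (unfold w, radial_geodesic; rewrite Cmod_mult, Cmod_R, Htau; ring).
  assert (Hw1 : Rabs r < 1) by (apply Rabs_def1; lra).
  assert (Hn : (1 - Cconj z * w)%C <> 0%C).
  { apply Cmod_gt_0. generalize (Cmod_minus_rev 1 (Cconj z * w)).
    rewrite Cmod_mult, Cmod_conj, Cmod_1, Hw.
    generalize (Cmod_ge_0 z) (Rabs_pos r). nra. }
  assert (Hden : 0 < Cmod (1 - Cconj z * w)%C ^ 2) by (apply pow_lt; now apply Cmod_gt_0).
  assert (Ht2 : Cmod tau ^ 2 = 1) by (rewrite Htau; ring).
  assert (E1 : stretch tau z r * (1 - r ^ 2) = 4 * Cmod (1 - Cconj z * w)%C ^ 2).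
  { transitivity (Cmod (tau - z)%C ^ 2 * (1 + r) ^ 2 + Cmod (tau + z)%C ^ 2 * (1 - r) ^ 2
                  + 2 * (1 - Cmod z ^ 2) * (1 - r ^ 2)).
    { unfold stretch. field. lra. }
    unfold w, radial_geodesic. rewrite !Cmod_sq_fst_snd in *.
    destruct tau as [a b], z as [x y]. simpl in *.
    assert (Hb : b * b = 1 - a * a) by lra.
    ring_simplify. replace (b ^ 2) with (1 - a ^ 2) by (simpl; lra). ring. }
  assert (E2 : Cmod (z - w)%C ^ 2
               = Cmod (1 - Cconj z * w)%C ^ 2 - (1 - Cmod z ^ 2) * (1 - r ^ 2)).
  { unfold w, radial_geodesic. rewrite !Cmod_sq_fst_snd in *.
    destruct tau as [a b], z as [x y]. simpl in *.
    assert (Hb : b * b = 1 - a * a) by lra.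
    ring_simplify. replace (b ^ 2) with (1 - a ^ 2) by (simpl; lra). ring. }
  assert (Hr2 : 0 < 1 - r ^ 2) by nra.
  assert (E3 : stretch tau z r = 4 * Cmod (1 - Cconj z * w)%C ^ 2 / (1 - r ^ 2)).
  { rewrite <- E1. field. lra. }
  split.
  - rewrite E3. apply Rdiv_lt_0_compat; lra.
  - unfold disc_aut. rewrite Cmod_div by assumption.
    unfold Rdiv at 1. rewrite Rpow_mult_distr, pow_inv, E2, E3. field. split; [lra | now apply Rgt_not_eq, Cmod_gt_0].
Qed.

Lemma hyp_dist_geodesic_le (tau z : C) (r r' : R) :
  Cmod tau = 1 -> Cmod z < 1 -> -1 < r < 1 -> -1 < r' < 1 ->
  (hyp_dist z (radial_geodesic tau r) <= hyp_dist z (radial_geodesic tau r')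
   <-> stretch tau z r <= stretch tau z r').
Proof.
  intros Htau Hz Hr Hr'.
  destruct (Cmod_disc_aut_geodesic tau z r Htau Hz Hr) as [P1 E1].
  destruct (Cmod_disc_aut_geodesic tau z r' Htau Hz Hr') as [P2 E2].
  assert (Hm : 0 < 4 * (1 - Cmod z ^ 2)) by (generalize (Cmod_ge_0 z); nra).
  set (M := 4 * (1 - Cmod z ^ 2)) in *.
  assert (HT : forall x g, 0 <= x -> 0 < g -> x ^ 2 = 1 - M / g -> 0 <= x < 1).
  { intros x g Hx Hg E. assert (0 < M / g) by now apply Rdiv_lt_0_compat. nra. }
  assert (T1 := HT _ _ (Cmod_ge_0 _) P1 E1). assert (T2 := HT _ _ (Cmod_ge_0 _) P2 E2).
  unfold hyp_dist. rewrite (ln_ratio_le _ _ T1 T2).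
  set (x := Cmod (disc_aut z (radial_geodesic tau r))) in *.
  set (x' := Cmod (disc_aut z (radial_geodesic tau r'))) in *.
  set (g := stretch tau z r) in *. set (g' := stretch tau z r') in *.
  assert (F1 : M = (1 - x ^ 2) * g) by (rewrite E1; field; lra).
  assert (F2 : M = (1 - x' ^ 2) * g') by (rewrite E2; field; lra).
  split; intros H.
  - assert (x ^ 2 <= x' ^ 2) by nra. assert (0 < 1 - x' ^ 2) by nra.
    assert ((1 - x' ^ 2) * g <= (1 - x' ^ 2) * g'); [|nra].
    rewrite <- F2, F1. apply Rmult_le_compat_r; lra.
  - assert (0 < 1 - x ^ 2) by nra.
    assert (HH : (1 - x' ^ 2) * g' <= (1 - x ^ 2) * g')
      by (rewrite <- F2, F1; apply Rmult_le_compat_l; lra).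
    apply Rmult_le_reg_r in HH; [nra | assumption].
Qed.

(** The minimum over [s] is at [s = rho]. *)
Lemma stretch_square (al be rho s M : R) : 0 < s -> be = al * rho ^ 2 ->
  al * s + be / s + 2 * M = (2 * al * rho + 2 * M) + al * ((s - rho) ^ 2 / s).
Proof. intros Hs ->. field. lra. Qed.

(** [rho] is the modulus of the Cayley transform of [z], and [r0 * tau] is the point of the disc
    with Cayley transform [rho]. *)
Lemma geodesic_proj_spec (tau z : C) :
  Cmod tau = 1 -> Cmod z < 1 ->
  let rho := Cmod (tau + z)%C / Cmod (tau - z)%C in
  let r0 := (rho - 1) / (rho + 1) in
  geodesic_proj tau z = radial_geodesic tau r0.
Proof.
  intros Htau Hz rho r0.
  assert (Ha : 0 < Cmod (tau - z)%C) by (generalize (Cmod_minus_rev tau z); lra).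
  assert (Hb : 0 < Cmod (tau + z)%C).
  { generalize (Cmod_minus_rev tau (- z)). rewrite Cmod_opp.
    replace (tau - - z)%C with (tau + z)%C by ring. lra. }
  assert (Hrho : 0 < rho) by now apply Rdiv_lt_0_compat.
  assert (Hr0 : -1 < r0 < 1).
  { unfold r0. split; [apply Rlt_div_r | apply Rlt_div_l]; lra. }
  assert (Es0 : (1 + r0) / (1 - r0) = rho) by (unfold r0; field; lra).
  assert (Hal : 0 < Cmod (tau - z)%C ^ 2) by now apply pow_lt.
  assert (Hg : forall r, -1 < r < 1 ->
     stretch tau z r = stretch tau z r0
       + Cmod (tau - z)%C ^ 2 * (((1 + r) / (1 - r) - rho) ^ 2 / ((1 + r) / (1 - r)))).
  { assert (H : forall r, -1 < r < 1 -> stretch tau z r =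
       (2 * Cmod (tau - z)%C ^ 2 * rho + 2 * (1 - Cmod z ^ 2))
       + Cmod (tau - z)%C ^ 2 * (((1 + r) / (1 - r) - rho) ^ 2 / ((1 + r) / (1 - r)))).
    { intros r Hr. unfold stretch. rewrite <- (stretch_square _ (Cmod (tau + z)%C ^ 2)).
      - field. lra.
      - apply Rdiv_lt_0_compat; lra.
      - unfold rho. field. lra. }
    intros r Hr. rewrite (H r Hr), (H r0 Hr0), Es0.
    unfold Rdiv. ring. }
  assert (Hs : forall r, -1 < r < 1 -> 0 < (1 + r) / (1 - r))
    by (intros r Hr; apply Rdiv_lt_0_compat; lra).
  assert (Hclosest : closest_on_geodesic tau z (radial_geodesic tau r0)).
  { split; [now exists r0|]. intros r Hr.
    apply hyp_dist_geodesic_le; auto. rewrite (Hg r Hr).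
    assert (0 <= ((1 + r) / (1 - r) - rho) ^ 2 / ((1 + r) / (1 - r))); [|nra].
    apply Rdiv_le_0_compat; [apply pow2_ge_0 | now apply Hs]. }
  assert (Huniq : forall p, closest_on_geodesic tau z p -> radial_geodesic tau r0 = p).
  { intros p [(r & Hr & ->) Hmin]. f_equal.
    specialize (Hmin r0 Hr0). apply hyp_dist_geodesic_le in Hmin; auto.
    rewrite (Hg r Hr) in Hmin. specialize (Hs r Hr).
    set (s := (1 + r) / (1 - r)) in *.
    assert (Hq : (s - rho) ^ 2 / s <= 0) by nra.
    assert (Hsr : (s - rho) ^ 2 <= 0).
    { replace ((s - rho) ^ 2) with ((s - rho) ^ 2 / s * s) by (field; lra). nra. }
    assert (Esr : s = rho) by nra.
    unfold r0. rewrite <- Esr. unfold s. field. lra. }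
  symmetry. apply Huniq. unfold geodesic_proj.
  apply (iota_correct (V := C_CompleteNormedModule)).
  exists (radial_geodesic tau r0). split; assumption.
Qed.

Lemma hyp_dist_0_geodesic (tau : C) (r : R) :
  Cmod tau = 1 -> hyp_dist 0%C (radial_geodesic tau r) = / 2 * ln ((1 + Rabs r) / (1 - Rabs r)).
Proof.
  intros Htau. unfold hyp_dist.
  replace (Cmod (disc_aut 0 (radial_geodesic tau r))) with (Rabs r); [reflexivity|].
  unfold disc_aut, radial_geodesic.
  replace ((0 - RtoC r * tau) / (1 - Cconj 0 * (RtoC r * tau)))%C with (- (RtoC r * tau))%C.
  - rewrite Cmod_opp, Cmod_mult, Cmod_R, Htau. ring.
  - replace (Cconj 0) with (RtoC 0) by (unfold Cconj, RtoC; simpl; f_equal; ring).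
    field. 
Qed.

(** In a closed horodisc through [0], the sharper constant [ln 2] is enough. With
    [T] the pseudo-hyperbolic distance to the geodesic, [1 - T ^ 2 >= / rho], and
    [(1 + T) / (1 - T) = (1 + T) ^ 2 / (1 - T ^ 2) <= 4 * rho]. *)
Lemma tangential_le_orthogonal (tau z : C) :
  Cmod tau = 1 -> Cmod z < 1 -> Cmod (tau - z)%C ^ 2 <= 1 - Cmod z ^ 2 ->
  hyp_dist z (geodesic_proj tau z) <= hyp_dist 0%C (geodesic_proj tau z) + ln 2.
Proof.
  intros Htau Hz Hhoro.
  rewrite (geodesic_proj_spec tau z Htau Hz).
  assert (Ha : 0 < Cmod (tau - z)%C) by (generalize (Cmod_minus_rev tau z); lra).
  (* The parallelogram identity and the horodisc condition give [rho >= 1]. *)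
  assert (Hab : Cmod (tau - z)%C ^ 2 <= Cmod (tau + z)%C ^ 2).
  { assert (E : Cmod (tau - z)%C ^ 2 + Cmod (tau + z)%C ^ 2 = 2 * Cmod tau ^ 2 + 2 * Cmod z ^ 2)
      by (rewrite !Cmod_sq_fst_snd; simpl; ring).
    rewrite Htau in E. generalize (pow2_ge_0 (Cmod z)). lra. }
  assert (Hab1 : Cmod (tau - z)%C <= Cmod (tau + z)%C) by (generalize (Cmod_ge_0 (tau + z)%C); nra).
  set (rho := Cmod (tau + z)%C / Cmod (tau - z)%C).
  set (r0 := (rho - 1) / (rho + 1)).
  assert (Hrho : 1 <= rho) by (apply (Rle_div_r 1 (Cmod (tau + z)%C)); lra).
  assert (Hr0 : 0 <= r0 < 1).
  { unfold r0. split; [apply Rdiv_le_0_compat; lra | apply Rlt_div_l; lra]. }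
  assert (Es0 : (1 + r0) / (1 - r0) = rho) by (unfold r0; field; lra).
  rewrite hyp_dist_0_geodesic, Rabs_pos_eq, Es0 by (assumption || lra).
  destruct (Cmod_disc_aut_geodesic tau z r0 Htau Hz ltac:(lra)) as [Pg Eg].
  unfold hyp_dist. set (T := Cmod (disc_aut z (radial_geodesic tau r0))) in *.
  set (M := 1 - Cmod z ^ 2) in *.
  assert (HM : 0 < M) by (unfold M; generalize (Cmod_ge_0 z); nra).
  assert (HT0 : 0 <= T) by apply Cmod_ge_0.
  assert (HMg : 0 < 4 * M / stretch tau z r0) by (apply Rdiv_lt_0_compat; lra).
  assert (HT1 : T < 1) by nra.
  assert (Hst : stretch tau z r0 = 2 * Cmod (tau - z)%C ^ 2 * rho + 2 * M).
  { unfold stretch. replace ((1 - r0) / (1 + r0)) with (/ rho) by (rewrite <- Es0; field; lra).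
    rewrite Es0. fold M.
    replace (Cmod (tau + z)%C ^ 2) with (Cmod (tau - z)%C ^ 2 * rho ^ 2)
      by (unfold rho; field; lra).
    field. lra. }
  assert (Hgle : stretch tau z r0 <= 4 * M * rho) by (rewrite Hst; nra).
  assert (Hinv : / rho <= 1 - T ^ 2).
  { rewrite Eg. replace (1 - (1 - 4 * M / stretch tau z r0)) with (4 * M / stretch tau z r0) by ring.
    apply (Rle_div_r (/ rho) (4 * M)); [lra|].
    apply Rle_trans with (/ rho * (4 * M * rho)).
    - apply Rmult_le_compat_l; [apply Rlt_le, Rinv_0_lt_compat; lra | assumption].
    - right. field. lra. }
  assert (Hbound : (1 + T) / (1 - T) <= 4 * rho).
  { apply (Rle_div_l (1 + T)); [lra|].
    assert (H1 : 1 <= rho * (1 - T ^ 2)).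
    { apply Rle_trans with (rho * / rho); [right; field; lra|]. apply Rmult_le_compat_l; lra. }
    assert (0 <= rho * (1 - T)) by (apply Rmult_le_pos; lra).
    nra. }
  assert (Hln : ln ((1 + T) / (1 - T)) <= ln (4 * rho)).
  { apply ln_le; [apply Rdiv_lt_0_compat; lra | exact Hbound]. }
  replace (4 * rho) with (2 * (2 * rho)) in Hln by ring.
  rewrite !ln_mult in Hln by lra. lra.
Qed.

Theorem proposition5p4 (phi : R -> C -> C) (tau : C)
  (Hphi : nonelliptic_semigroup phi)
  (Htau : denjoy_wolff_point phi tau) :
  forall t : R, 0 <= t ->
    tangential_speed phi tau t <= orthogonal_speed phi tau t + 4 * ln 2.
Proof.
  intros t Ht.
  assert (Hin : unit_disc (phi t 0%C)).
  { apply (nes_self _ Hphi); [exact Ht|]. unfold unit_disc. rewrite Cmod_0. lra. }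
  generalize (tangential_le_orthogonal tau (phi t 0%C) (proj1 Htau) Hin
                (horodisc_invariance phi tau t Hphi Htau Ht)).
  unfold tangential_speed, orthogonal_speed.
  assert (0 < ln 2) by (rewrite <- ln_1; apply ln_increasing; lra).
  lra.
Qed.
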